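(* Let $c_0,d_0>0$ be a pair of Bourgain–Tzafriri constants (as defined in the context). Let $n\ge1$, let $A:\mathbb{R}\to M_{n\times n}$ be a continuous matrix function and let $\theta>0$ be such that $\|A(t)e_i\|\ge\theta$ for $1\le i\le n$ and $\|A(t)\|\le1$, for all $t\in\mathbb{R}$. Then for any $\gamma\in(0,1)$ and any positive integer $m\le\lceil (d_0/7)n\theta^2\rceil$ there exist continuous matrix functions $L:\mathbb{R}\to M_{m\times n}$ and $R:\mathbb{R}\to M_{n\times m}$ such that $L(t)A(t)R(t)=I_m$ and $\|L(t)\|\,\|R(t)\|\le C/\theta$ for all $t\in\mathbb{R}$, where $C=(\gamma c_0)^{-1}$.
   Context: $M_{m\times n}$ denotes the space of real $m\times n$ matrices; $I_m$ is the $m\times m$ identity matrix; $e_1,\dots,e_n$ is the standard basis of $\mathbb{R}^n$; $\|\cdot\|$ on vectors is the Euclidean norm and on matrices the operator norm. A matrix function is continuous if its entries are continuous. A pair of Bourgain–Tzafriri constants is a pair of universal constants $c_0,d_0>0$ with the following property (such a pair exists by a theorem of Bourgain and Tzafriri): for every $n\ge1$ and every $A\in M_{n\times n}$ with $\|Ae_i\|=1$ for $1\le i\le n$, there exists $\sigma\subset\{1,\dots,n\}$ with $|\sigma|\ge d_0 n\|A\|^{-2}$ such that for all real scalars $(a_j)_{j\in\sigma}$, $\big\|\sum_{j\in\sigma}a_jAe_j\big\|\ge c_0\big(\sum_{j\in\sigma}|a_j|^2\big)^{1/2}$. *)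

(* Defs.v *)
From HB Require Import structures.
From mathcomp Require Import all_boot all_order all_algebra.
From mathcomp Require Import all_classical all_reals all_analysis.
Set Implicit Arguments.
Unset Strict Implicit.
Unset Printing Implicit Defensive.
Import Order.TTheory GRing.Theory Num.Theory.
Import numFieldNormedType.Exports.
Local Open Scope classical_set_scope.
Local Open Scope ring_scope.

(* The library norm `|_| on 'M[R]_(m, n) is the maximum of
   the absolute values of the entries, hence the two norms below. *)

Definition enorm (R : realType) (n : nat) (x : 'cV[R]_n) : R :=
  Num.sqrt (\sum_(i < n) x i ord0 ^+ 2).

(* The set of reals is nonempty (x = 0) and bounded above, so that sup is its
   actual least upper bound. *)
Definition opnorm (R : realType) (m n : nat) (M : 'M[R]_(m, n)) : R :=
  sup [set enorm (M *m x) | x in [set x : 'cV[R]_n | enorm x <= 1]].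

Definition std_basis (R : realType) (n : nat) (i : 'I_n) : 'cV[R]_n :=
  delta_mx i ord0.

Definition continuous_mx (R : realType) (m n : nat) (M : R -> 'M[R]_(m, n)) :
  Prop := forall i j, continuous (fun t : R => M t i j).

(* Only the values a j for j \in sigma matter. *)
Definition Bourgain_Tzafriri (R : realType) (c0 d0 : R) : Prop :=
  [/\ 0 < c0, 0 < d0 &
    forall (n : nat) (A : 'M[R]_n), (1 <= n)%N ->
      (forall i : 'I_n, enorm (A *m std_basis R i) = 1) ->
      exists sigma : {set 'I_n},
        d0 * n%:R * opnorm A ^- 2 <= #|sigma|%:R /\
        forall a : 'I_n -> R,
          c0 * Num.sqrt (\sum_(j in sigma) `|a j| ^+ 2) <=
          enorm (\sum_(j in sigma) a j *: (A *m std_basis R j))].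

(* Main.v *)
(* For m = 1 the constant column e_1 works, since c0 <= 1.  For m >= 2, every
   A(t) admits a coordinate subspace of dimension at least 7m - 6 >= 3m on
   which it is bounded below by k = c0 theta (Bourgain-Tzafriri applied to A(t)
   with normalised columns).  Given any orthonormal m-frame G, such a subspace
   therefore contains an orthonormal m-frame F with F orthogonal to G and
   A(t) F orthogonal to A(t) G, and the rotation cos G + sin F is through
   orthonormal frames on which A(t) keeps the lower bound.  Performing such
   rotations on short time intervals, where A oscillates by at most
   (1 - gamma) k / 2, gives a continuous frame R(t) with
   |A(t) R(t) x| >= gamma k |x|; then L = (B^T B)^-1 B^T with B = A R. *)
Require Import Defs.
From HB Require Import structures.
From mathcomp Require Import all_boot all_order all_algebra.
From mathcomp Require Import all_classical all_reals all_analysis.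
From mathcomp Require Import ring lra zify.
Import Order.TTheory GRing.Theory Num.Theory.
Import numFieldNormedType.Exports.
Local Open Scope classical_set_scope.
Local Open Scope ring_scope.
Set Implicit Arguments.
Unset Strict Implicit.
Unset Printing Implicit Defensive.

(** * Euclidean inner product, Euclidean norm and operator norm *)

Definition dot (R : realType) (n : nat) (x y : 'cV[R]_n) : R :=
  (x^T *m y) ord0 ord0.

Lemma dotC (R : realType) (n : nat) (x y : 'cV[R]_n) : dot x y = dot y x.
Proof. by rewrite /dot !mxE; apply: eq_bigr => i _; rewrite !mxE mulrC. Qed.

Lemma dotDr (R : realType) (n : nat) (x y z : 'cV[R]_n) :
  dot x (y + z) = dot x y + dot x z.
Proof. by rewrite /dot mulmxDr mxE. Qed.

Lemma dotDl (R : realType) (n : nat) (x y z : 'cV[R]_n) :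
  dot (x + y) z = dot x z + dot y z.
Proof. by rewrite dotC dotDr !(dotC z). Qed.

Lemma dotZr (R : realType) (n : nat) (a : R) (x y : 'cV[R]_n) :
  dot x (a *: y) = a * dot x y.
Proof. by rewrite /dot -scalemxAr mxE. Qed.

Lemma dotZl (R : realType) (n : nat) (a : R) (x y : 'cV[R]_n) :
  dot (a *: x) y = a * dot x y.
Proof. by rewrite dotC dotZr dotC. Qed.

Lemma enorm_ge0 (R : realType) (n : nat) (x : 'cV[R]_n) : 0 <= enorm x.
Proof. exact: sqrtr_ge0. Qed.

Lemma sqr_enorm (R : realType) (n : nat) (x : 'cV[R]_n) :
  enorm x ^+ 2 = dot x x.
Proof.
rewrite /enorm sqr_sqrtr; last by apply: sumr_ge0 => i _; exact: sqr_ge0.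
by rewrite /dot !mxE; apply: eq_bigr => i _; rewrite !mxE expr2.
Qed.

Lemma enormZ (R : realType) (n : nat) (a : R) (x : 'cV[R]_n) :
  enorm (a *: x) = `|a| * enorm x.
Proof.
apply/eqP; rewrite -(@eqrXn2 _ 2) ?mulr_ge0 ?enorm_ge0 //.
by rewrite exprMn !sqr_enorm dotZl dotZr real_normK ?num_real // mulrA expr2.
Qed.

Lemma enorm0 (R : realType) (n : nat) : enorm (0 : 'cV[R]_n) = 0.
Proof. by rewrite -(scale0r 0) enormZ normr0 mul0r. Qed.

Lemma enorm_eq0 (R : realType) (n : nat) (x : 'cV[R]_n) :
  (enorm x == 0) = (x == 0).
Proof.
apply/idP/eqP => [/eqP x0|->]; last by rewrite enorm0.
have s0 : \sum_(i < n) x i ord0 ^+ 2 = 0.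
  apply/eqP; rewrite eq_le -sqrtr_eq0 -/(enorm x) x0 eqxx /=.
  by apply: sumr_ge0 => i _; exact: sqr_ge0.
apply/matrixP => i j; rewrite ord1 mxE; apply/eqP; rewrite -sqrf_eq0.
by rewrite (psumr_eq0P _ s0) // => k _; exact: sqr_ge0.
Qed.

(** For nonzero vectors, the square of [enorm] of |y| x - |x| y expands to 2 |x| |y| (|x| |y| -
    [dot x y]), and the positive factor 2 |x| |y| can be cancelled. *)
Lemma cauchy_schwarz_dot (R : realType) (n : nat) (x y : 'cV[R]_n) :
  dot x y <= enorm x * enorm y.
Proof.
have [/eqP x0|x0] := boolP (enorm x == 0).
  move/eqP: (x0); rewrite enorm_eq0 => /eqP ->.
  by rewrite enorm0 mul0r -(scale0r 0) dotZl mul0r.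
have [/eqP y0|y0] := boolP (enorm y == 0).
  move/eqP: (y0); rewrite enorm_eq0 => /eqP ->.
  by rewrite enorm0 mulr0 -(scale0r 0) dotZr mul0r.
have xp : 0 < enorm x by rewrite lt0r x0 enorm_ge0.
have yp : 0 < enorm y by rewrite lt0r y0 enorm_ge0.
have := sqr_ge0 (enorm (enorm y *: x + (- enorm x) *: y)).
rewrite sqr_enorm dotDl !dotDr !dotZl !dotZr (dotC y x) -!sqr_enorm.
have xy := mulr_gt0 xp yp.
set a := enorm x in xp xy *; set b := enorm y in yp xy *; set d := dot x y.
have -> : b * (b * a ^+ 2) + b * (- a * d) + (- a * (b * d) + - a * (- a * b ^+ 2))
   = (2 * (a * b)) * (a * b - d) by ring.
by rewrite pmulr_rge0 ?subr_ge0 // mulr_gt0.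
Qed.

Lemma enormD (R : realType) (n : nat) (x y : 'cV[R]_n) :
  enorm (x + y) <= enorm x + enorm y.
Proof.
rewrite -(@ler_pXn2r _ 2) ?nnegrE ?addr_ge0 ?enorm_ge0 //.
rewrite sqr_enorm dotDl !dotDr (dotC y x) sqrrD -!sqr_enorm.
have := cauchy_schwarz_dot x y; lra.
Qed.

Lemma ler_abs_enorm (R : realType) (n : nat) (x : 'cV[R]_n) (i : 'I_n) :
  `|x i ord0| <= enorm x.
Proof.
rewrite -sqrtr_sqr /enorm ler_wsqrtr // (bigD1 i) //= lerDl.
by apply: sumr_ge0 => j _; exact: sqr_ge0.
Qed.

Lemma enorm_le_sum (R : realType) (n : nat) (x : 'cV[R]_n) :
  enorm x <= \sum_i `|x i ord0|.
Proof.
have s0 : 0 <= \sum_i `|x i ord0| by apply: sumr_ge0.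
rewrite -(@ler_pXn2r _ 2) ?nnegrE ?enorm_ge0 // sqr_enorm /dot mxE expr2.
rewrite mulr_suml; apply: ler_sum => i _; rewrite mxE -expr2.
rewrite -real_normK ?num_real // expr2 ler_wpM2l //.
by rewrite (bigD1 i) //= lerDl; apply: sumr_ge0.
Qed.

(** This crude bound makes the supremum in [opnorm] finite, and later turns entrywise continuity
    into continuity of the operator. *)
Lemma enorm_mulmx_le (R : realType) (m n : nat) (M : 'M[R]_(m, n))
    (x : 'cV[R]_n) :
  enorm (M *m x) <= (\sum_i \sum_j `|M i j|) * enorm x.
Proof.
apply: (le_trans (enorm_le_sum _)); rewrite mulr_suml; apply: ler_sum => i _.
rewrite mxE mulr_suml; apply: (le_trans (ler_norm_sum _ _ _)).
apply: ler_sum => j _; rewrite normrM ler_wpM2l //; exact: ler_abs_enorm.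
Qed.

Lemma has_ubound_opnorm (R : realType) (m n : nat) (M : 'M[R]_(m, n)) :
  has_ubound [set enorm (M *m x) | x in [set x : 'cV[R]_n | enorm x <= 1]].
Proof.
exists (\sum_i \sum_j `|M i j|) => _ [y /= y1 <-].
apply: (le_trans (enorm_mulmx_le M y)).
rewrite ler_piMr //; apply: sumr_ge0 => i _; exact: sumr_ge0.
Qed.

Lemma enorm_mulmx_le_opnorm (R : realType) (m n : nat) (M : 'M[R]_(m, n))
    (x : 'cV[R]_n) :
  enorm (M *m x) <= opnorm M * enorm x.
Proof.
have [->|x0] := eqVneq x 0; first by rewrite mulmx0 !enorm0 mulr0.
have xp : 0 < enorm x by rewrite lt0r enorm_eq0 x0 enorm_ge0.
rewrite -ler_pdivrMr //.
have -> : enorm (M *m x) / enorm x = enorm (M *m ((enorm x)^-1 *: x)).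
  by rewrite -scalemxAr enormZ mulrC gtr0_norm ?invr_gt0.
apply: ub_le_sup; first exact: has_ubound_opnorm.
exists ((enorm x)^-1 *: x) => //=.
by rewrite enormZ gtr0_norm ?invr_gt0 // mulVf ?gt_eqF.
Qed.

Lemma opnorm_le (R : realType) (m n : nat) (M : 'M[R]_(m, n)) (c : R) :
  0 <= c -> (forall x, enorm (M *m x) <= c * enorm x) -> opnorm M <= c.
Proof.
move=> c0 Mc; apply: ge_sup.
  by exists (enorm (M *m 0)); exists 0 => //=; rewrite enorm0.
move=> _ [y /= y1 <-]; apply: (le_trans (Mc y)).
by rewrite ler_piMr.
Qed.

Lemma opnorm_ge0 (R : realType) (m n : nat) (M : 'M[R]_(m, n)) :
  0 <= opnorm M.
Proof.
apply: ub_le_sup; first exact: has_ubound_opnorm.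
by exists 0 => /=; rewrite ?mulmx0 enorm0.
Qed.

(** * Orthonormal columns, lower bounds, rotations and the least-squares left inverse *)

Definition orthonormal_cols (R : realType) (m n : nat) (G : 'M[R]_(n, m)) :=
  G^T *m G = 1%:M.

Definition bounded_below (R : realType) (m n : nat) (k : R) (M : 'M[R]_(n, m)) :=
  forall x, k * enorm x <= enorm (M *m x).

Lemma dot_mulmxl (R : realType) (m n : nat) (M : 'M[R]_(n, m)) x y :
  dot (M *m x) y = dot x (M^T *m y).
Proof. by rewrite /dot trmx_mul mulmxA. Qed.

Lemma sqr_enorm_mulmx (R : realType) (m n : nat) (M : 'M[R]_(n, m)) x :
  enorm (M *m x) ^+ 2 = dot x (M^T *m M *m x).
Proof. by rewrite sqr_enorm /dot trmx_mul !mulmxA. Qed.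

Lemma enorm_orthonormal_cols (R : realType) (m n : nat) (G : 'M[R]_(n, m)) x :
  orthonormal_cols G -> enorm (G *m x) = enorm x.
Proof.
move=> G1; apply/eqP; rewrite -(@eqrXn2 _ 2) ?enorm_ge0 //.
by rewrite sqr_enorm_mulmx G1 mul1mx sqr_enorm.
Qed.

(** Pythagoras: the ranges of [U] and [V] are orthogonal, so the cross terms vanish. *)
Lemma sqr_enorm_rotation (R : realType) (m n : nat) (U V : 'M[R]_(n, m))
    (c s : R) x : V^T *m U = 0 ->
  enorm ((c *: U + s *: V) *m x) ^+ 2 =
  c ^+ 2 * enorm (U *m x) ^+ 2 + s ^+ 2 * enorm (V *m x) ^+ 2.
Proof.
move=> VU; have o : dot (V *m x) (U *m x) = 0.
  by rewrite /dot trmx_mul -!mulmxA (mulmxA V^T) VU mul0mx mulmx0 mxE.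
rewrite mulmxDl -!scalemxAl sqr_enorm dotDl !dotDr !dotZl !dotZr.
rewrite (dotC (U *m x)) o -!sqr_enorm; ring.
Qed.

Lemma orthonormal_cols_rotation (R : realType) (m n : nat)
    (U V : 'M[R]_(n, m)) (c s : R) : c ^+ 2 + s ^+ 2 = 1 ->
  orthonormal_cols U -> orthonormal_cols V -> V^T *m U = 0 ->
  orthonormal_cols (c *: U + s *: V).
Proof.
rewrite /orthonormal_cols => cs U1 V1 VU.
have UV : U^T *m V = 0 by rewrite -[LHS]trmxK trmx_mul trmxK VU trmx0.
have -> : (c *: U + s *: V)^T = c *: U^T + s *: V^T.
  by apply/matrixP => i j; rewrite !mxE.
rewrite mulmxDl !mulmxDr -!scalemxAl -!scalemxAr.
by rewrite U1 V1 UV VU !scaler0 addr0 add0r !scalerA -scalerDl -!expr2 cs scale1r.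
Qed.

(** The squared norm is a convex combination, with weights c^2 and s^2, of two squares that are at
    least (k |x|)^2. *)
Lemma bounded_below_rotation (R : realType) (m n : nat)
    (U V : 'M[R]_(n, m)) (k c s : R) : c ^+ 2 + s ^+ 2 = 1 -> 0 <= k ->
  bounded_below k U -> bounded_below k V -> V^T *m U = 0 ->
  bounded_below k (c *: U + s *: V).
Proof.
move=> cs k0 Uk Vk VU x.
have kx : 0 <= k * enorm x by rewrite mulr_ge0 ?enorm_ge0.
rewrite -(@ler_pXn2r _ 2) ?nnegrE ?enorm_ge0 // sqr_enorm_rotation //.
rewrite -[leLHS]mul1r -cs mulrDl.
by apply: lerD; rewrite ler_wpM2l ?sqr_ge0 // ler_pXn2r ?nnegrE ?enorm_ge0.
Qed.

(** If v B^T B = 0 for a row v, then |B v^T|^2 = v B^T B v^T = 0, and the lower bound forces v =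
    0. *)
Lemma bounded_below_unitmx (R : realType) (m n : nat) (k : R)
    (B : 'M[R]_(n, m)) : 0 < k -> bounded_below k B -> B^T *m B \in unitmx.
Proof.
move=> k0 Bk; rewrite -row_free_unit -kermx_eq0; apply/eqP/row_matrixP => i.
rewrite row0; set v := row i _.
have vB : v *m (B^T *m B) = 0.
  by apply/sub_kermxP; exact: row_sub.
have Bv : enorm (B *m v^T) = 0.
  apply/eqP; rewrite -sqrf_eq0 sqr_enorm /dot trmx_mul trmxK.
  by rewrite -mulmxA (mulmxA B^T) mulmxA vB mul0mx mxE.
have : k * enorm v^T <= 0 by rewrite -Bv.
rewrite pmulr_rle0 // => v0; have : enorm v^T == 0.
  by rewrite eq_le v0 enorm_ge0.
by rewrite enorm_eq0 => /eqP v0'; rewrite -[v]trmxK v0' trmx0.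
Qed.

(** The least-squares solution x satisfies B^T B x = B^T y, so |B x|^2 is the inner product of B x
    and y. Cauchy-Schwarz then gives k |x| <= |B x| <= |y|. *)
Lemma opnorm_left_inverse_le (R : realType) (m n : nat) (k : R)
    (B : 'M[R]_(n, m)) : 0 < k -> bounded_below k B ->
  opnorm (invmx (B^T *m B) *m B^T) <= k^-1.
Proof.
move=> k0 Bk; apply: opnorm_le; first by rewrite invr_ge0 ltW.
move=> y; rewrite mulrC ler_pdivlMr // mulrC.
set x := _ *m y; apply: (le_trans (Bk x)).
have Bu := bounded_below_unitmx k0 Bk.
have Bx : enorm (B *m x) ^+ 2 = dot (B *m x) y.
  rewrite sqr_enorm_mulmx dot_mulmxl; congr (dot x _).
  by rewrite /x -(mulmxA (invmx _)) mulKVmx.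
have [/eqP ->|] := boolP (enorm (B *m x) == 0); first exact: enorm_ge0.
move=> Bx0; have Bxp : 0 < enorm (B *m x) by rewrite lt0r Bx0 enorm_ge0.
rewrite -(ler_pM2l Bxp) -expr2 Bx; exact: cauchy_schwarz_dot.
Qed.

(** Columns are added one at a time: the conditions W v = 0 and F^T v = 0 number fewer than n, so
    they have a nonzero solution, which is normalised. *)
Lemma exists_orthonormal_cols (R : realType) (p n m : nat) (W : 'M[R]_(p, n)) :
  (p + m <= n)%N ->
  exists2 F : 'M[R]_(n, m), orthonormal_cols F & W *m F = 0.
Proof.
elim: m => [|m IHm] pm.
  exists 0; first by apply/matrixP => -[].
  by rewrite mulmx0.
have [|F F1 WF] := IHm; first by apply: leq_trans pm; rewrite leq_add2l.
have : kermx (col_mx W F^T)^T != 0.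
  rewrite kermx_eq0 /row_free mxrank_tr neq_ltn.
  by rewrite (leq_ltn_trans (rank_leq_row _)) // -addnS.
move=> /rowV0Pn[v /sub_kermxP vk v0].
have : col_mx W F^T *m v^T = 0 by rewrite -[LHS]trmxK trmx_mul trmxK vk trmx0.
rewrite mul_col_mx => vk'.
have /eq_col_mx[Wv Fv] : col_mx (W *m v^T) (F^T *m v^T) = col_mx 0 0.
  by rewrite vk' col_mx0.
have vp : 0 < enorm v^T by rewrite lt0r enorm_ge0 enorm_eq0 trmx_eq0 v0.
set u := (enorm v^T)^-1 *: v^T.
have u1 : u^T *m u = 1%:M.
  apply/matrixP => i j; rewrite !ord1 [LHS](_ : _ = dot u u) // -sqr_enorm.
  by rewrite /u enormZ gtr0_norm ?invr_gt0 // mulVf ?gt_eqF // expr1n mxE.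
have Fu : F^T *m u = 0 by rewrite /u -scalemxAr Fv scaler0.
have uF : u^T *m F = 0 by rewrite -[LHS]trmxK trmx_mul trmxK Fu trmx0.
have Wu : W *m u = 0 by rewrite /u -scalemxAr Wv scaler0.
rewrite -addn1; exists (row_mx F u); last by rewrite mul_mx_row WF Wu row_mx0.
rewrite /orthonormal_cols tr_row_mx mul_col_row F1 Fu uF u1.
by rewrite -scalar_mx_block.
Qed.

(** * Coordinate subspaces on which the matrix is bounded below *)

Lemma mulmx_std_basis (R : realType) (m n : nat) (M : 'M[R]_(m, n)) i j :
  (M *m std_basis R j) i ord0 = M i j.
Proof. by rewrite /std_basis -colE mxE. Qed.

Lemma mulmx_sum_std_basis (R : realType) (m n : nat) (M : 'M[R]_(m, n)) x :
  M *m x = \sum_j x j ord0 *: (M *m std_basis R j).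
Proof.
apply/matrixP => i k; rewrite ord1 summxE mxE; apply: eq_bigr => j _.
by rewrite [RHS]mxE mulmx_std_basis mulrC.
Qed.

Lemma enorm_std_basis (R : realType) (n : nat) (i : 'I_n) :
  enorm (std_basis R i) = 1.
Proof.
rewrite /enorm (bigD1 i) //= big1 ?addr0; last first.
  by move=> j /negPf ji; rewrite mxE ji expr0n.
by rewrite mxE !eqxx expr1n sqrtr1.
Qed.

Lemma ler_enorm_scaled (R : realType) (n : nat) (c : R) (x y : 'cV[R]_n) :
  0 <= c -> (forall i, `|x i ord0| <= c * `|y i ord0|) ->
  enorm x <= c * enorm y.
Proof.
move=> c0 xy; rewrite -(@ler_pXn2r _ 2) ?nnegrE ?mulr_ge0 ?enorm_ge0 //.
rewrite exprMn !sqr_enorm /dot !mxE mulr_sumr; apply: ler_sum => i _.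
rewrite !mxE -!expr2 -[leLHS]real_normK ?num_real //.
rewrite -[y i ord0 ^+ 2]real_normK ?num_real // -exprMn.
by rewrite ler_pXn2r ?nnegrE ?mulr_ge0.
Qed.

(* Apply the Bourgain-Tzafriri property to [A] with normalised columns. *)
Lemma Bourgain_Tzafriri_large_columns (R : realType) (c0 d0 : R) (n : nat)
    (A : 'M[R]_n) (theta : R) :
  Bourgain_Tzafriri c0 d0 -> (0 < n)%N -> 0 < theta ->
  (forall i, theta <= enorm (A *m std_basis R i)) -> opnorm A <= 1 ->
  exists2 sigma : {set 'I_n}, d0 * n%:R * theta ^+ 2 <= #|sigma|%:R &
    forall x : 'cV_n, (forall i, i \notin sigma -> x i ord0 = 0) ->
      c0 * theta * enorm x <= enorm (A *m x).
Proof.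
move=> [c0p d0p BT] n0 t0 At A1.
pose nu i := enorm (A *m std_basis R i).
have nup i : 0 < nu i by exact: lt_le_trans (At i).
pose D : 'M[R]_n := diag_mx (\row_i (nu i)^-1).
have DE x i : (D *m x) i ord0 = (nu i)^-1 * (x : 'cV_n) i ord0.
  by rewrite /D mul_diag_mx !mxE.
have ADe i : (A *m D) *m std_basis R i = (nu i)^-1 *: (A *m std_basis R i).
  rewrite -mulmxA scalemxAr; congr (A *m _).
  apply/matrixP => j k; rewrite ord1 DE !mxE.
  by case: eqVneq => [->//|_] /=; rewrite !mulr0.
have ADe1 i : enorm ((A *m D) *m std_basis R i) = 1.
  by rewrite ADe enormZ gtr0_norm ?invr_gt0 // mulVf ?gt_eqF // nup.
(* The diagonal entries of [D] are at most [theta^-1] and [A] has norm at most 1; this is the source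
   of the factor [theta ^+ 2] in the cardinality bound. *)
have ADn : opnorm (A *m D) <= theta^-1.
  apply: opnorm_le => [|x]; first by rewrite invr_ge0 ltW.
  rewrite -mulmxA; apply: (le_trans (enorm_mulmx_le_opnorm _ _)).
  apply: (@le_trans _ _ (1 * enorm (D *m x))).
    by rewrite ler_wpM2r ?enorm_ge0.
  rewrite mul1r; apply: ler_enorm_scaled; first by rewrite invr_ge0 ltW.
  move=> i; rewrite DE normrM ler_wpM2r //.
  by rewrite gtr0_norm ?invr_gt0 // lef_pV2 ?posrE // At.
(* Positivity is needed to invert the previous bound, since the inverse of 0 is 0 by convention; a
   unit column provides it. *)
have AD0 : 0 < opnorm (A *m D).
  have := enorm_mulmx_le_opnorm (A *m D) (std_basis R (Ordinal n0)).
  by rewrite ADe1 enorm_std_basis mulr1; exact: lt_le_trans.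
have [sigma [sn sb]] := BT n (A *m D) n0 ADe1.
exists sigma.
  apply: le_trans sn; rewrite ler_wpM2l ?mulr_ge0 ?ler0n ?(ltW d0p) //.
  rewrite -exprVn ler_pXn2r ?nnegrE ?invr_ge0 ?(ltW AD0) ?(ltW t0) //.
  by rewrite -[theta]invrK lef_pV2 ?posrE ?invr_gt0.
(* The coefficients nu_j x_j undo the normalisation, so that the combination is A x; nu_j >= theta
   then yields the factor [theta]. *)
move=> x x0; have := sb (fun j => nu j * x j ord0).
have -> : \sum_(j in sigma) (nu j * x j ord0) *: (A *m D *m std_basis R j) =
          A *m x.
  rewrite (mulmx_sum_std_basis A) [RHS](bigID (mem sigma)) /=.
  rewrite [X in _ = _ + X]big1 ?addr0; last first.
    by move=> i /x0 ->; rewrite scale0r.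
  apply: eq_bigr => j _; rewrite ADe scalerA mulrAC mulfV ?mul1r //.
  by rewrite gt_eqF.
apply: le_trans; rewrite -mulrA ler_wpM2l ?(ltW c0p) //.
rewrite -[theta]gtr0_norm // -sqrtr_sqr -sqrtrM ?sqr_ge0 //.
rewrite ler_wsqrtr // mulr_sumr [leLHS](bigID (mem sigma)) /=.
rewrite [X in _ + X]big1 ?addr0; last first.
  by move=> i /x0 ->; rewrite expr0n mulr0.
apply: ler_sum => j _; rewrite normrM exprMn !real_normK ?num_real //.
rewrite ler_wpM2r ?sqr_ge0 //.
by rewrite ler_pXn2r ?nnegrE ?(ltW t0) ?(ltW (nup _)) ?At.
Qed.

Definition frame (R : realType) (m n : nat) (k : R) (M : 'M[R]_n)
    (G : 'M[R]_(n, m)) :=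
  orthonormal_cols G /\ bounded_below k (M *m G).

(** The 2m rows of [W] leave room for two families of m conditions: orthogonality of F to a given
    frame G, and of M F to M G. *)
Definition frame_in_kernel (R : realType) (m n : nat) (k : R) (M : 'M[R]_n) :=
  forall W : 'M[R]_(m + m, n),
    exists2 F : 'M[R]_(n, m), frame k M F & W *m F = 0.

(** Vectors supported in [sigma] form a space of dimension at least 3m; the 2m conditions of [W]
    leave at least m dimensions for the frame. *)
Lemma frame_in_kernel_supported (R : realType) (m n : nat) (k : R)
    (M : 'M[R]_n) (sigma : {set 'I_n}) :
  (3 * m <= #|sigma|)%N ->
  (forall x : 'cV_n, (forall i, i \notin sigma -> x i ord0 = 0) ->
      k * enorm x <= enorm (M *m x)) ->
  frame_in_kernel m k M.
Proof.
move=> m3 sk W.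
(* [S] reads off the coordinates outside [sigma], so S F = 0 says that the columns of F are
   supported in [sigma]. *)
pose S : 'M[R]_(#|~: sigma|, n) := \matrix_(i, j) (j == enum_val i)%:R.
have [|F F1] := @exists_orthonormal_cols R _ n m (col_mx W S).
  by have := cardsC sigma; rewrite card_ord; lia.
rewrite mul_col_mx -col_mx0 => /eq_col_mx[WF SF].
exists F => //; split=> // x; rewrite -(enorm_orthonormal_cols x F1) -mulmxA.
apply: sk => i iS; have iS' : i \in ~: sigma by rewrite inE.
have : (S *m F *m x) (enum_rank_in iS' i) ord0 = 0.
  by rewrite SF mul0mx mxE.
rewrite -mulmxA mxE (bigD1 i) //= big1 ?addr0; last first.
  move=> j /negPf ji; rewrite mxE enum_rankK_in // ji mul0r //.
by rewrite mxE enum_rankK_in // eqxx mul1r.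
Qed.

(** * Continuity of matrix functions *)

Lemma continuous_max2 (R : realType) (f g : R -> R) :
  continuous f -> continuous g -> continuous (fun t => Num.max (f t) (g t)).
Proof. by move=> fc gc t; apply: continuous_max; [exact: fc|exact: gc]. Qed.

Lemma continuous_min2 (R : realType) (f g : R -> R) :
  continuous f -> continuous g -> continuous (fun t => Num.min (f t) (g t)).
Proof. by move=> fc gc t; apply: continuous_min; [exact: fc|exact: gc]. Qed.

Lemma continuous_sum (R : realType) (I : Type) (r : seq I) (P : pred I)
    (F : I -> R -> R) :
  (forall i, continuous (F i)) -> continuous (fun t => \sum_(i <- r | P i) F i t).
Proof. by move=> Fc; apply: continuous_big => //; exact: add_continuous. Qed.

Lemma continuous_prod (R : realType) (I : Type) (r : seq I) (P : pred I)
    (F : I -> R -> R) :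
  (forall i, continuous (F i)) -> continuous (fun t => \prod_(i <- r | P i) F i t).
Proof. by move=> Fc; apply: continuous_big => //; exact: mul_continuous. Qed.

Lemma continuous_mul (R : realType) (f g : R -> R) :
  continuous f -> continuous g -> continuous (fun t => f t * g t).
Proof. by move=> fc gc t; apply: cvgM; [exact: fc|exact: gc]. Qed.

Lemma continuous_mx_comp (R : realType) (m n : nat) (M : R -> 'M[R]_(m, n))
    (f : R -> R) :
  continuous_mx M -> continuous f -> continuous_mx (fun t => M (f t)).
Proof.
move=> Mc fc i j t; apply: (@continuous_comp _ _ _ f (fun s => M s i j)).
  exact: fc.
exact: Mc.
Qed.

Lemma continuous_mx_cst (R : realType) (m n : nat) (M : 'M[R]_(m, n)) :
  continuous_mx (fun _ : R => M).
Proof. by move=> i j t; exact: cvg_cst. Qed.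

Lemma eq_continuous_mx (R : realType) (m n : nat) (M N : R -> 'M[R]_(m, n)) :
  M =1 N -> continuous_mx M -> continuous_mx N.
Proof. by move=> /funext ->. Qed.

Lemma continuous_mxD (R : realType) (m n : nat) (M N : R -> 'M[R]_(m, n)) :
  continuous_mx M -> continuous_mx N -> continuous_mx (fun t => M t + N t).
Proof.
move=> Mc Nc i j; rewrite (_ : (fun t => _) = fun t => M t i j + N t i j).
  by move=> t; apply: cvgD; [exact: Mc|exact: Nc].
by apply/funext => t; rewrite mxE.
Qed.

Lemma continuous_mxZ (R : realType) (m n : nat) (f : R -> R)
    (M : R -> 'M[R]_(m, n)) :
  continuous f -> continuous_mx M -> continuous_mx (fun t => f t *: M t).
Proof.
move=> fc Mc i j; rewrite (_ : (fun t => _) = fun t => f t * M t i j).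
  by apply: continuous_mul => //; exact: Mc.
by apply/funext => t; rewrite mxE.
Qed.

Lemma continuous_mxB (R : realType) (m n : nat) (M N : R -> 'M[R]_(m, n)) :
  continuous_mx M -> continuous_mx N -> continuous_mx (fun t => M t - N t).
Proof.
move=> Mc Nc; apply: (@eq_continuous_mx _ _ _ (fun t => M t + (-1) *: N t)).
  by move=> t; rewrite scaleN1r.
by apply: continuous_mxD => //; apply: continuous_mxZ => // t; exact: cvg_cst.
Qed.

Lemma continuous_mxM (R : realType) (m n p : nat) (M : R -> 'M[R]_(m, n))
    (N : R -> 'M[R]_(n, p)) :
  continuous_mx M -> continuous_mx N -> continuous_mx (fun t => M t *m N t).
Proof.
move=> Mc Nc i j.
rewrite (_ : (fun t => _) = fun t => \sum_k M t i k * N t k j).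
  by apply: continuous_sum => k; apply: continuous_mul; [exact: Mc|exact: Nc].
by apply/funext => t; rewrite mxE.
Qed.

Lemma continuous_mx_tr (R : realType) (m n : nat) (M : R -> 'M[R]_(m, n)) :
  continuous_mx M -> continuous_mx (fun t => (M t)^T).
Proof.
move=> Mc i j; rewrite (_ : (fun t => _) = fun t => M t j i); first exact: Mc.
by apply/funext => t; rewrite mxE.
Qed.

Lemma continuous_det (R : realType) (n : nat) (M : R -> 'M[R]_n) :
  continuous_mx M -> continuous (fun t => \det (M t)).
Proof.
move=> Mc; apply: continuous_sum => s; apply: continuous_mul.
  by move=> t; exact: cvg_cst.
by apply: continuous_prod => i; exact: Mc.
Qed.

(** By Cramer's rule the inverse is the adjugate divided by the determinant, and both are polynomial
    in the entries. *)
Lemma continuous_mx_inv (R : realType) (n : nat) (M : R -> 'M[R]_n) :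
  (forall t, M t \in unitmx) -> continuous_mx M ->
  continuous_mx (fun t => invmx (M t)).
Proof.
move=> Mu Mc.
apply: (@eq_continuous_mx _ _ _ (fun t => (\det (M t))^-1 *: \adj (M t))).
  by move=> t; rewrite /invmx Mu.
apply: continuous_mxZ.
  move=> t; apply: cvgV; last exact: continuous_det.
  by have := Mu t; rewrite unitmxE unitfE.
move=> i j; rewrite (_ : (fun t => _) = fun t => cofactor (M t) j i).
  apply: continuous_mul; first by move=> t; exact: cvg_cst.
  apply: continuous_det => k l.
  rewrite (_ : (fun t => _) = fun t => M t (lift j k) (lift i l)).
    exact: Mc.
  by apply/funext => t; rewrite !mxE.
by apply/funext => t; rewrite mxE.
Qed.

Lemma continuous_mx_near (R : realType) (n : nat) (A : R -> 'M[R]_n) (e x : R) :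
  continuous_mx A -> 0 < e ->
  exists2 d, 0 < d &
    forall y, `|x - y| < d -> forall v, enorm ((A y - A x) *m v) <= e * enorm v.
Proof.
move=> Ac e0; pose f t := \sum_i \sum_j `|(A t - A x) i j|.
have fc : continuous f.
  apply: continuous_sum => i; apply: continuous_sum => j t.
  apply: cvg_norm; apply: continuous_mxB => //; exact: continuous_mx_cst.
have f0 : f x = 0.
  by rewrite /f big1 // => i _; rewrite big1 // => j _; rewrite subrr mxE normr0.
have /cvgrPdist_lt /(_ e e0) := fc x; rewrite f0 => /nbhs_ballP[d /= d0 dx].
exists d => // y xy v; apply: (le_trans (enorm_mulmx_le _ v)).
rewrite ler_wpM2r ?enorm_ge0 //.
have := dx y xy; rewrite sub0r normrN => /ltW; apply: le_trans.
exact: ler_norm.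
Qed.

(** * Transport of frames along an interval *)

(** The path is constant outside the interval, so that consecutive paths can be glued by addition.
    Only intermediate frames drop to [k']: the final one has the full constant [k] again, so no loss
    accumulates under concatenation. *)
Definition transport (R : realType) (m n : nat) (k k' : R) (A : R -> 'M[R]_n)
    (a b : R) :=
  forall G : 'M[R]_(n, m), frame k (A a) G ->
  exists Gf : 'M[R]_(n, m) * (R -> 'M[R]_(n, m)),
    [/\ continuous_mx Gf.2, (forall t, t <= a -> Gf.2 t = G),
        (forall t, b <= t -> Gf.2 t = Gf.1), frame k (A b) Gf.1 &
        forall t, a <= t <= b -> frame k' (A t) (Gf.2 t)].

(** Both paths equal G1 at b, the first ever after and the second ever before. Hence f + (g - G1) is
    f up to b and g from b on, and it is continuous as a sum. *)
Lemma transport_trans (R : realType) (m n : nat) (k k' : R) (A : R -> 'M[R]_n)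
    (a b c : R) : a <= b -> b <= c ->
  transport m k k' A a b -> transport m k k' A b c -> transport m k k' A a c.
Proof.
move=> ab bc Tab Tbc G0 /Tab[[G1 f] /= [fc f0 f1 fG1 fab]].
have [[G2 g] /= [gc g0 g1 gG2 gbc]] := Tbc _ fG1.
have E1 t : t <= b -> f t + (g t - G1) = f t by move=> /g0 ->; rewrite subrr addr0.
have E2 t : b <= t -> f t + (g t - G1) = g t by move=> /f1 ->; rewrite subrKC.
exists (G2, fun t => f t + (g t - G1)); split=> //=.
- by apply: continuous_mxD => //; apply: continuous_mxB => //; exact: continuous_mx_cst.
- by move=> t ta; rewrite E1 ?f0 // (le_trans ta).
- by move=> t ct; rewrite E2 ?g1 // (le_trans _ ct).
- move=> t /andP[ta tc]; have [tb|/ltW bt] := leP t b.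
    by rewrite E1 //; apply: fab; rewrite ta.
  by rewrite E2 //; apply: gbc; rewrite bt.
Qed.

(** Triangle inequality at the vector G x, which has the norm of x. *)
Lemma bounded_below_perturb (R : realType) (m n : nat) (k e : R)
    (M N : 'M[R]_n) (G : 'M[R]_(n, m)) : orthonormal_cols G ->
  (forall v, enorm ((M - N) *m v) <= e * enorm v) ->
  bounded_below k (M *m G) -> bounded_below (k - e) (N *m G).
Proof.
move=> G1 MN Mk x; have := MN (G *m x).
rewrite (enorm_orthonormal_cols x G1).
have := Mk x; rewrite -!mulmxA.
have : enorm (M *m (G *m x)) <=
       enorm ((M - N) *m (G *m x)) + enorm (N *m (G *m x)).
  apply: le_trans (enormD _ _).
  by rewrite -mulmxDl subrK.
rewrite mulrBl; lra.
Qed.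

(* The new frame [F] is chosen orthogonal to [G] and with [A b *m F] orthogonal
   to [A b *m G], so that rotating [G] to [F] keeps both the orthonormality and
   the lower bound. *)
Lemma transport_small (R : realType) (m n : nat) (k e : R) (A : R -> 'M[R]_n)
    (a b : R) : a < b -> 0 <= e -> e <= k -> frame_in_kernel m k (A b) ->
  (forall t, a <= t <= b -> forall v, enorm ((A t - A b) *m v) <= e * enorm v) ->
  transport m k (k - e - e) A a b.
Proof.
move=> ab e0 ek Fb osc G [G1 Ga].
(* The two blocks encode F orthogonal to G and A(b) F orthogonal to A(b) G. *)
have [F [F1 Fk]] := Fb (col_mx G^T (G^T *m (A b)^T *m A b)).
rewrite mul_col_mx -col_mx0 => /eq_col_mx[GF AGF].
have FG : F^T *m G = 0 by rewrite -[LHS]trmxK trmx_mul trmxK GF trmx0.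
have AFG : (A b *m F)^T *m (A b *m G) = 0.
  by rewrite -[LHS]trmxK trmx_mul trmxK [(A b *m G)^T]trmx_mul !mulmxA AGF trmx0.
(* A clamped linear ramp from 0 at a to 1 at b; with c = sqrt (1 - s^2), the pair (c, s) runs along
   a quarter of the unit circle. *)
pose s (t : R) := Num.max 0 (Num.min 1 ((t - a) / (b - a))).
have sc : continuous s.
  apply: continuous_max2; first by move=> t; exact: cvg_cst.
  apply: continuous_min2; first by move=> t; exact: cvg_cst.
  apply: continuous_mul; last by move=> t; exact: cvg_cst.
  by move=> t; apply: cvgB; [exact: cvg_id|exact: cvg_cst].
pose c (t : R) := Num.sqrt (1 - s t ^+ 2).
have cc : continuous c.
  move=> t; apply: (@continuous_comp _ _ _ (fun t => 1 - s t ^+ 2)).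
    apply: cvgB; first exact: cvg_cst.
    by apply: continuous_mul.
  exact: sqrt_continuous.
have ba : 0 < b - a by rewrite subr_gt0.
have s0 t : t <= a -> s t = 0.
  move=> ta; apply/max_idPl; rewrite ge_min; apply/orP; right.
  by rewrite pmulr_lle0 ?invr_gt0 // subr_le0.
have s1 t : b <= t -> s t = 1.
  move=> bt; rewrite /s (min_idPl _) ?max_r ?ler01 //.
  by rewrite ler_pdivlMr // mul1r lerD2r.
have s01 t : 0 <= s t <= 1.
  by rewrite /s le_max lexx /= ge_max ler01 ge_min lexx.
have cs t : c t ^+ 2 + s t ^+ 2 = 1.
  rewrite sqr_sqrtr ?subrK // subr_ge0 expr_le1 //.
    by have /andP[] := s01 t.
  by have /andP[] := s01 t.
exists (F, fun t => c t *: G + s t *: F); split => //=.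
- by apply: continuous_mxD; apply: continuous_mxZ => //; exact: continuous_mx_cst.
- move=> t /s0 st; rewrite /c st expr0n subr0 sqrtr1 scale1r scale0r addr0 //.
- move=> t /s1 st; rewrite /c st expr1n subrr sqrtr0 scale1r scale0r add0r //.
move=> t tab; have O := orthonormal_cols_rotation (cs t) G1 F1 FG.
(* One [e] is lost in comparing A(t) with A(b) on the rotated frame, the other in comparing A(a)
   with A(b) on G. *)
split=> //; apply: (bounded_below_perturb (M := A b)) => //.
  by move=> v; rewrite -opprB mulNmx -scaleN1r enormZ normrN1 mul1r; exact: osc.
rewrite mulmxDr -!scalemxAr; apply: bounded_below_rotation => //.
- by rewrite subr_ge0.
- by apply: (bounded_below_perturb (M := A a)) => //; apply: osc; rewrite lexx ltW.
- move=> x; apply: le_trans (Fk x); rewrite ler_wpM2r ?enorm_ge0 //; lra.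
Qed.

Lemma transport_refl (R : realType) (m n : nat) (k k' : R) (A : R -> 'M[R]_n)
    (a : R) : k' <= k -> transport m k k' A a a.
Proof.
move=> k'k G Ga; exists (G, fun=> G); split=> //=; first exact: continuous_mx_cst.
move=> t /le_anti <-; case: Ga => G1 Ga; split=> // x; apply: le_trans (Ga x).
by rewrite ler_wpM2r ?enorm_ge0.
Qed.

(** Compactness through a supremum: let s be the supremum of the points of [a, b] reachable from a.
    A reachable point close to s leads directly to b when b < s + d, and otherwise to s + d / 2,
    contradicting the choice of s. *)
Lemma interval_induction (R : realType) (P : R -> R -> Prop) :
  (forall x, P x x) ->
  (forall x y z, x <= y -> y <= z -> P x y -> P y z -> P x z) ->
  (forall x, exists2 d, 0 < d &
    forall y z, x - d < y -> y < z -> z < x + d -> P y z) ->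
  forall a b, a <= b -> P a b.
Proof.
move=> Pr Pt Pl a b ab.
pose S := [set x | a <= x <= b /\ P a x].
have Sa : S a by split=> //; rewrite lexx.
have Sb : has_sup S by split; [exists a|exists b => x [/andP[]]].
have [d d0 Pd] := Pl (sup S).
have [x [/andP[ax xb] Pax] xs] := sup_adherent d0 Sb.
have xS : x <= sup S by apply: ub_le_sup; [exact: Sb.2|split=> //; rewrite ax].
have [xb'|] := ltP x b; last first.
  by move=> bx; have <- : x = b by apply/le_anti; rewrite bx xb.
have [bs|sb] := ltP b (sup S + d).
  by apply: (Pt _ x) => //; exact: Pd.
pose y := sup S + d / 2.
have xy : x < y by rewrite /y; lra.
have Sy : S y.
  split; first by rewrite /y; apply/andP; split; lra.
  by apply: (Pt _ x) => //; [exact: ltW|apply: Pd => //; rewrite /y; lra].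
have : y <= sup S by apply: ub_le_sup => //; exact: Sb.2.
by rewrite /y; lra.
Qed.

Lemma transport_segment (R : realType) (m n : nat) (k k' : R)
    (A : R -> 'M[R]_n) (a b : R) : 0 < k' -> k' < k -> continuous_mx A ->
  (forall t, frame_in_kernel m k (A t)) -> a <= b -> transport m k k' A a b.
Proof.
move=> k'0 k'k Ac Fk; apply: interval_induction.
- by move=> x; apply: transport_refl; exact: ltW.
- by move=> x y z; exact: transport_trans.
(* A small rotation costs 2e = k - k'. Oscillation at most e / 2 about x gives at most e between two
   points near x. *)
pose e := (k - k') / 2; have e0 : 0 < e by rewrite /e; lra.
move=> x; have [//||d d0 dx] := @continuous_mx_near _ _ A (e / 2) x.
  by rewrite /e; lra.
exists d => // y z xy yz zx.
rewrite (_ : k' = k - e - e); last by rewrite /e; lra.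
apply: transport_small => //; [lra|rewrite /e; lra|].
move=> t /andP[yt tz] v; rewrite -(subrKA (A x)) mulmxDl.
apply: (le_trans (enormD _ _)).
have -> : e * enorm v = e / 2 * enorm v + e / 2 * enorm v by lra.
apply: lerD; first by apply: dx; rewrite ltr_norml; apply/andP; split; lra.
rewrite -opprB mulNmx -scaleN1r enormZ normrN1 mul1r.
by apply: dx; rewrite ltr_norml; apply/andP; split; lra.
Qed.

(** * Frames over the whole line and the factorisation *)

Lemma frame_unit_vector (R : realType) (n : nat) (k : R) (M : 'M[R]_n)
    (u : 'cV[R]_n) : enorm u = 1 -> k <= enorm (M *m u) -> frame k M u.
Proof.
move=> u1 ku; split=> [|x].
  apply/matrixP => i j; rewrite !ord1 [LHS](_ : _ = dot u u) // -sqr_enorm.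
  by rewrite u1 expr1n mxE.
have -> : M *m u *m x = x ord0 ord0 *: (M *m u).
  by apply/matrixP => i j; rewrite ord1 mxE big_ord1 [RHS]mxE mulrC.
have -> : enorm x = `|x ord0 ord0| by rewrite /enorm big_ord1 sqrtr_sqr.
by rewrite enormZ mulrC ler_wpM2l.
Qed.

(** Test case: the identity matrix of size 1, where d0 > 0 makes [sigma] nonempty. *)
Lemma Bourgain_Tzafriri_le1 (R : realType) (c0 d0 : R) :
  Bourgain_Tzafriri c0 d0 -> c0 <= 1.
Proof.
move=> BT; have d0p : 0 < d0 by case: BT.
have [||sigma sn sb] :=
  @Bourgain_Tzafriri_large_columns R c0 d0 1 1%:M 1 BT isT ltr01.
- by move=> i; rewrite mul1mx enorm_std_basis.
- by apply: opnorm_le => // x; rewrite mul1mx mul1r.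
have /card_gt0P[i isigma] : (0 < #|sigma|)%N.
  by rewrite -(ltr_nat R); apply: lt_le_trans sn; rewrite expr1n !mulr1.
have := sb (std_basis R i); rewrite mul1mx enorm_std_basis !mulr1; apply.
move=> j jsigma; rewrite mxE; case: eqVneq jsigma => [->|//].
by rewrite isigma.
Qed.

(** Transports over the intervals [N, N + 1] are chained, each starting from the frame where the
    previous one ended. *)
Lemma frame_on_half_line (R : realType) (m n : nat) (k k' : R)
    (A : R -> 'M[R]_n) (G0 : 'M[R]_(n, m)) : 0 < k' -> k' < k ->
  continuous_mx A -> (forall t, frame_in_kernel m k (A t)) ->
  frame k (A 0) G0 ->
  exists f : R -> 'M[R]_(n, m),
    [/\ continuous_mx f, f 0 = G0 & forall t, 0 <= t -> frame k' (A t) (f t)].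
Proof.
move=> k'0 k'k Ac Fk G0k.
have /choice[next nextP] : forall p : nat * 'M[R]_(n, m), exists Gf,
    frame k (A p.1%:R) p.2 ->
    [/\ continuous_mx Gf.2, (forall t, t <= p.1%:R -> Gf.2 t = p.2),
        (forall t, p.1.+1%:R <= t -> Gf.2 t = Gf.1), frame k (A p.1.+1%:R) Gf.1 &
        forall t, p.1%:R <= t <= p.1.+1%:R -> frame k' (A t) (Gf.2 t)].
  (* The choice function must be total; when G is not a frame the premise fails and a dummy value
     serves. *)
  move=> [N G] /=; have [Gk|nGk] := pselect (frame k (A N%:R) G); last first.
    by exists (G, fun=> G).
  have := @transport_segment R m n k k' A N%:R N.+1%:R k'0 k'k Ac Fk.
  by rewrite ler_nat leqnSn => /(_ isT G Gk)[Gf GfP]; exists Gf.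
pose Gs := fix Gs N := if N is N'.+1 then (next (N', Gs N')).1 else G0.
have Gsk N : frame k (A N%:R) (Gs N).
  by elim: N => [//|N /(nextP (N, _))[]].
(* [F N] follows the first N paths and then stays constant; each increment vanishes before its
   interval starts. *)
pose F := fix F N t :=
  if N is N'.+1 then F N' t + ((next (N', Gs N')).2 t - Gs N') else G0.
have Fc N : continuous_mx (F N).
  elim: N => [|N IHN] /=; first exact: continuous_mx_cst.
  have [fc _ _ _ _] := nextP (N, _) (Gsk N).
  by apply: continuous_mxD => //; apply: continuous_mxB => //; exact: continuous_mx_cst.
have FS N t : t <= N%:R -> F N.+1 t = F N t.
  have [_ f0 _ _ _] := nextP (N, _) (Gsk N).
  by move=> tN /=; rewrite f0 // subrr addr0.
have FD N p t : t <= N%:R -> F (N + p)%N t = F N t.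
  move=> tN; elim: p => [|p IHp]; first by rewrite addn0.
  by rewrite addnS FS // (le_trans tN) // ler_nat leq_addr.
have FE N N' t : t <= N%:R -> t <= N'%:R -> F N t = F N' t.
  by move=> tN tN'; rewrite -(FD N N') // addnC FD.
have Fend N t : N%:R <= t -> F N t = Gs N.
  elim: N t => [//|N IHN] t Nt /=.
  have [_ _ f1 _ _] := nextP (N, _) (Gsk N).
  by rewrite f1 // IHN ?subrKC // (le_trans _ Nt) // ler_nat.
have Fk' N t : 0 <= t <= N%:R -> frame k' (A t) (F N t).
  elim: N => [|N IHN] /andP[t0 tN].
    have -> : t = 0 by apply/le_anti; rewrite t0 tN.
    case: G0k => G01 G0k; split=> // x; apply: le_trans (G0k x).
    by rewrite ler_wpM2r ?enorm_ge0 // ltW.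
  have [tN'|/ltW Nt] := leP t N%:R; first by rewrite FS //; apply: IHN; rewrite t0.
  have [_ _ _ _ f'] := nextP (N, _) (Gsk N).
  by rewrite /= Fend // subrKC; apply: f'; rewrite Nt.
(* Any integer above t may serve as index, since [F N t] is the same for all N >= t. *)
pose T (t : R) := (Num.truncn t).+1.
have tT t : t <= (T t)%:R by apply/ltW; exact: truncnS_gt.
exists (fun t => F (T t) t); split=> [i j t||t t0].
(* [T] jumps at integers, so the single index T (t + 1) is used for all s < t + 1. *)
- have Ft : F (T (t + 1)) s i j @[s --> t] --> F (T t) t i j.
    rewrite (FE (T t) (T (t + 1)) t) //; first exact: Fc.
    by apply: le_trans (tT _); rewrite lerDl.
  apply: cvg_trans Ft; apply: near_eq_cvg; near=> s.
  rewrite (FE (T s) (T (t + 1)) s) //; apply: le_trans (tT _); apply: ltW.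
  by near: s; apply: lt_nbhsl; rewrite ltrDl.
- by rewrite (FE _ 0%N) //.
- by apply: Fk'; rewrite t0 tT.
Unshelve. all: by end_near. Qed.

(** Half-line frames for A(t) and A(-t) are built from a common initial frame [G0]; each is frozen
    at [G0] on the other side of 0, so they are glued by addition. *)
Lemma frame_on_line (R : realType) (m n : nat) (k k' : R)
    (A : R -> 'M[R]_n) : 0 < k' -> k' < k ->
  continuous_mx A -> (forall t, frame_in_kernel m k (A t)) ->
  exists2 f : R -> 'M[R]_(n, m),
    continuous_mx f & forall t, frame k' (A t) (f t).
Proof.
(* The zero matrix W imposes no condition: this only extracts an initial frame for [A 0]. *)
move=> k'0 k'k Ac Fk; have [G0 G0k _] := Fk 0 0.
have oc : continuous (fun t : R => - t) by move=> t; apply: cvgN; exact: cvg_id.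
have maxc : continuous (fun t : R => Num.max t 0).
  by apply: continuous_max2 => t; [exact: cvg_id|exact: cvg_cst].
have maxNc : continuous (fun t : R => Num.max (- t) 0).
  by apply: continuous_max2 => // t; exact: cvg_cst.
have [f [fc f0 fk]] := frame_on_half_line k'0 k'k Ac Fk G0k.
have [||g [gc g0 gk]] := frame_on_half_line k'0 k'k (continuous_mx_comp Ac oc) (G0 := G0).
- by move=> t; exact: Fk.
- by rewrite oppr0.
exists (fun t => f (Num.max t 0) + (g (Num.max (- t) 0) - G0)).
  apply: continuous_mxD; first exact: continuous_mx_comp.
  by apply: continuous_mxB; [exact: continuous_mx_comp|exact: continuous_mx_cst].
move=> t; have [t0|t0] := leP 0 t.
  by rewrite [Num.max (- t) 0]max_r ?oppr_le0 // g0 subrr addr0; exact: fk.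
rewrite f0 subrKC max_l ?oppr_ge0 ?ltW //.
by rewrite -{1}(opprK t); apply: gk; rewrite oppr_ge0 ltW.
Qed.

Unset Implicit Arguments.

Theorem theorem3p9 (R : realType) (c0 d0 : R)
    (hBT : Bourgain_Tzafriri c0 d0)
    (n : nat) (hn : (1 <= n)%N)
    (A : R -> 'M[R]_n) (hA : continuous_mx A)
    (theta : R) (htheta : 0 < theta)
    (hAe : forall (t : R) (i : 'I_n), theta <= enorm (A t *m std_basis R i))
    (hAnorm : forall t : R, opnorm (A t) <= 1)
    (gamma : R) (hgamma0 : 0 < gamma) (hgamma1 : gamma < 1)
    (m : nat) (hm0 : (0 < m)%N)
    (hm : (m%:Z <= Num.ceil (d0 / 7%:R * n%:R * theta ^+ 2))%R) :
  exists (L : R -> 'M[R]_(m, n)) (Rt : R -> 'M[R]_(n, m)),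
    [/\ continuous_mx L,
        continuous_mx Rt,
        forall t : R, L t *m A t *m Rt t = 1%:M &
        forall t : R, opnorm (L t) * opnorm (Rt t) <= (gamma * c0)^-1 / theta].
Proof.
have c0p : 0 < c0 by case: hBT.
have d0p : 0 < d0 by case: hBT.
have k0 : 0 < c0 * theta by rewrite mulr_gt0.
have k'0 : 0 < gamma * c0 * theta by rewrite -mulrA mulr_gt0.
have BT t := Bourgain_Tzafriri_large_columns hBT hn htheta (hAe t) (hAnorm t).
suff [f fc fk] : exists2 f : R -> 'M[R]_(n, m),
    continuous_mx f & forall t, frame (gamma * c0 * theta) (A t) (f t).
  have Bc : continuous_mx (fun t => A t *m f t) by exact: continuous_mxM.
  have Bu t := bounded_below_unitmx k'0 (fk t).2.
  exists (fun t => invmx ((A t *m f t)^T *m (A t *m f t)) *m (A t *m f t)^T), f.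
  split=> // [|t|t].
  - apply: continuous_mxM; last exact: continuous_mx_tr.
    by apply: continuous_mx_inv => //; apply: continuous_mxM => //; exact: continuous_mx_tr.
  - by rewrite -!mulmxA mulVmx // !mulmxA.
  (* The left inverse contributes (gamma c0 theta)^-1, and the isometry f(t) at most 1. *)
  - rewrite -invfM -[leRHS]mulr1; apply: ler_pM; rewrite ?opnorm_ge0 //.
      exact: opnorm_left_inverse_le (fk t).2.
    apply: opnorm_le => // x; rewrite mul1r enorm_orthonormal_cols //.
    exact: (fk t).1.
(* The count |sigma| >= 7m - 6 yields 3m only for m >= 2. *)
have [m1|m2] := leqP m 1.
  have {m1 hm hm0} -> : m = 1%N by lia.
  pose i0 := Ordinal hn; exists (fun=> std_basis R i0).
    exact: continuous_mx_cst.
  move=> t; apply: frame_unit_vector; first exact: enorm_std_basis.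
  apply: le_trans (hAe t i0); rewrite ler_piMl ?(ltW htheta) //.
  rewrite -[leRHS]mulr1; apply: ler_pM; rewrite ?(ltW hgamma0) ?(ltW hgamma1) ?(ltW c0p) //.
  exact: Bourgain_Tzafriri_le1 hBT.
apply: (frame_on_line (k := c0 * theta)) => //.
  by rewrite -mulrA gtr_pMl.
move=> t; have [sigma sn sb] := BT t.
apply: frame_in_kernel_supported sb.
(* The ceiling exceeds the integer m - 1, hence so does d0 n theta^2 / 7, and |sigma| >= d0 n
   theta^2 > 7 (m - 1). *)
suff : (7 * m.-1 < #|sigma|)%N by lia.
rewrite -(ltr_nat R); apply: lt_le_trans sn.
have : m.-1%:Z < Num.ceil (d0 / 7%:R * n%:R * theta ^+ 2).
  by apply: lt_le_trans hm; rewrite ltz_nat; lia.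
rewrite ceil_gt_int natrM => h; rewrite -ltr_pdivlMl ?ltr0n //.
by apply: lt_le_trans h _; lra.
Qed.
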